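(* Let $b,N\ge1$, $\sigma>0$, $\mathbf{m}_1,\dots,\mathbf{m}_b\in\mathbb{R}_{\ge0}^N$, $P=\frac1b\sum_{i=1}^b\mathcal{N}(\mathbf{m}_i,\sigma^2I_N)$, $Q=\mathcal{N}(0,\sigma^2I_N)$, $n\in\{1,\dots,N\}$ and $\beta\in(0,1)$. Consider the per-step dominating-pair procedure described in the context. (Remove) The pair of distributions returned by the procedure for the ''remove'' relation dominates the pair $(P_{y_n\mid y_{1:n-1}},Q_{y_n\mid y_{1:n-1}})$ with probability at least $1-\beta$ over $y\sim P$. (Add) The pair of distributions returned by the procedure for the ''add'' relation dominates the pair $(Q_{y_n\mid y_{1:n-1}},P_{y_n\mid y_{1:n-1}})$ with probability at least $1-\beta$ over $y\sim Q$.
   Context: Conditional distributions: $P_{y_n\mid y_{1:n-1}}=\sum_{i=1}^bP(z=i\mid y_{1:n-1})\,\mathcal{N}(m_{i,n},\sigma^2)$ with $P(z=i\mid y_{1:n-1})=\mathcal{N}(y_{1:n-1}\mid\mathbf{m}_{i,1:n-1},\sigma^2I)\big/\sum_{j=1}^b\mathcal{N}(y_{1:n-1}\mid\mathbf{m}_{j,1:n-1},\sigma^2I)$ (uniform for $n=1$), and $Q_{y_n\mid y_{1:n-1}}=\mathcal{N}(0,\sigma^2)$. Here $\mathcal{N}(\cdot\mid\mu,\Sigma)$ is the Gaussian density and $\mathbf{m}_{j,1:n-1}$ the first $n-1$ coordinates of $\mathbf{m}_j$. Dominance: a pair $(\hat P,\hat Q)$ dominates $(P',Q')$ if $H_\gamma(P'\|Q')\le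 H_\gamma(\hat P\|\hat Q)$ for all $\gamma>0$, where $H_\gamma(P\|Q)=\mathbb{E}_{x\sim P}[\max\{1-\gamma\frac{dQ}{dP}(x),0\}]$. Procedure (input: $\mathbf{m}_1,\dots,\mathbf{m}_b$, $n$, $\beta$, and relation ''remove'' or ''add''): 1. Let $\pi$ be a permutation of $\{1,\dots,b\}$ with $m_{\pi(1),n}\le\dots\le m_{\pi(b),n}$. Let $\mu_j=\mathbf{m}_{\pi(j),1:n-1}\in\mathbb{R}^{n-1}$. 2. Set $\overline\lambda_1=1$. For each $i\in\{2,\dots,b\}$ let $\tilde P=\frac1{i-1}\sum_{j=1}^{i-1}\mathcal{N}(\mu_j,\sigma^2I)$, $\tilde Q=\mathcal{N}(\mu_i,\sigma^2I)$, and let $\tilde R=\frac1b\sum_{k=1}^b\mathcal{N}(\mu_k,\sigma^2I)$ for ''remove'', $\tilde R=\mathcal{N}(0,\sigma^2I)$ for ''add''. Let $\tau_i\in\mathbb{R}$ be any number with $\Pr_{x\sim\tilde R}\big[\log\frac{d\tilde P}{d\tilde Q}(x)<\tau_i\big]\le\beta/(b-1)$, and set $\overline\lambda_i=s(-\log(i-1)-\tau_i)$ with $s(x)=(1+e^{-x})^{-1}$. 3. Set $p_i=\overline\lambda_i\prod_{j=i+1}^b(1-\overline\lambda_j)$ for $1\le i\le b$. 4. Let $P^{(n)}=\sum_{j=1}^bp_j\,\mathcal{N}(m_{\pi(j),n},\sigma^2)$ and $Q^{(n)}=\mathcal{N}(0,\sigma^2)$. Return $(P^{(n)},Q^{(n)})$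 for ''remove'' and $(Q^{(n)},P^{(n)})$ for ''add''. *)

(* Defs.v *)
From HB Require Import structures.
From mathcomp Require Import all_boot all_order all_algebra perm.
From mathcomp Require Import all_classical all_reals all_analysis.
Set Implicit Arguments.
Unset Strict Implicit.
Unset Printing Implicit Defensive.
Import Order.TTheory GRing.Theory Num.Def Num.Theory.
Import numFieldNormedType.Exports.
Local Open Scope classical_set_scope.
Local Open Scope charge_scope.
Local Open Scope ring_scope.

(* Weights are not required to sum to 1, hence a finite measure rather than a
   probability; all the weights used below do sum to 1. *)
Section mixture.
Local Open Scope ereal_scope.
Context d (T : measurableType d) (R : realType) (I : finType).
Variables (w : I -> {nonneg R}) (P : I -> probability T R).

Definition mixture (A : set T) : \bar R := \sum_(i : I) (w i)%:num%:E * P i A.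

Let mixture0 : mixture set0 = 0.
Proof. by rewrite /mixture big1// => i _; rewrite measure0 mule0. Qed.

Let mixture_ge0 A : 0 <= mixture A.
Proof. by apply: sume_ge0 => i _; rewrite mule_ge0. Qed.

Let mixture_sigma_additive : semi_sigma_additive mixture.
Proof.
move=> F mF tF mUF; rewrite [X in _ --> X](_ : _ =
    lim ((fun n => \sum_(0 <= i < n) mixture (F i)) @ \oo)).
  by apply: is_cvg_ereal_nneg_natsum => k _; exact: mixture_ge0.
rewrite nneseries_sum//; last by move=> i n _; rewrite mule_ge0.
apply: eq_bigr => /= i _.
exact: (measure_semi_bigcup (mscale (w i) (P i))).
Qed.

HB.instance Definition _ := isMeasure.Build _ _ _ mixture
  mixture0 mixture_ge0 mixture_sigma_additive.

Let mixture_fin : fin_num_fun mixture.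
Proof.
move=> A mA; apply/sum_fin_numP => i _ _.
by rewrite fin_numM// fin_num_measure.
Qed.

HB.instance Definition _ := Measure_isFinite.Build _ _ _ mixture mixture_fin.

End mixture.

Definition uniform_mixture d (T : measurableType d) (R : realType) (k : nat)
    (P : 'I_k -> probability T R) : {finite_measure set T -> \bar R} :=
  mixture (fun _ : 'I_k => (k%:R^-1)%:nng) P.

Section product_law.
Context d (T : measurableType d) (R : realType).

Definition tuple_cons k (x : T * k.-tuple T) : k.+1.-tuple T :=
  [tuple of x.1 :: x.2].

Lemma measurable_tuple_cons k : measurable_fun setT (@tuple_cons k).
Proof. exact: measurable_cons. Qed.

HB.instance Definition _ k :=
  isMeasurableFun.Build _ _ _ _ (@tuple_cons k) (@measurable_tuple_cons k).

(* The law of a tuple of independent variables with laws P 0, ..., P k.-1. *)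
Fixpoint product_law k : ('I_k -> probability T R) -> probability (k.-tuple T) R :=
  match k return ('I_k -> probability T R) -> probability (k.-tuple T) R with
  | 0 => fun _ => \d_([tuple])
  | k'.+1 => fun P =>
      distribution (P ord0 \x product_law (fun i => P (lift ord0 i)))%E
        (@tuple_cons k')
  end.

End product_law.

Definition zero_vec (R : realType) k : k.-tuple R := [tuple 0 | _ < k].

Section gaussian.
Variable R : realType.
Implicit Types (k : nat) (s : R).

(* s is the standard deviation: gauss m s is N(m, s^2 I_k). *)
Definition gauss k (m : k.-tuple R) s : probability (k.-tuple (measurableTypeR R)) R :=
  product_law (fun i => normal_prob (tnth m i) s).

Definition gauss_pdf k (m : k.-tuple R) s (x : k.-tuple R) : R :=
  (Num.sqrt ((s ^+ 2 * pi *+ 2) ^+ k))^-1 *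
  expR (- (\sum_(i < k) (tnth x i - tnth m i) ^+ 2) / (s ^+ 2 *+ 2)).

Lemma gauss_pdf_ge0 k (m : k.-tuple R) s x : 0 <= gauss_pdf m s x.
Proof. by rewrite mulr_ge0 ?expR_ge0// invr_ge0 sqrtr_ge0. Qed.

End gaussian.

Section dominance.
Local Open Scope ereal_scope.
Context d (T : measurableType d) (R : realType).
Implicit Types P Q : {finite_measure set T -> \bar R}.

(* 'd Q '/d P is only meaningful when Q is absolutely continuous w.r.t. P. *)
Definition hockey_stick (g : R) P Q : \bar R :=
  \int[P]_x maxe (1 - g%:E * ('d (charge_of_finite_measure Q) '/d P) x) 0.

Definition dominates (hPQ PQ : {finite_measure set T -> \bar R} *
                               {finite_measure set T -> \bar R}) : Prop :=
  forall g : R, (0 < g)%R ->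
    hockey_stick g PQ.1 PQ.2 <= hockey_stick g hPQ.1 hPQ.2.

End dominance.

(* Tuples are indexed from 0, so n : 'I_N stands for the (n + 1)-st coordinate
   and the coordinates before it form a tuple of length n. *)
Definition prefix (T : Type) N (n : 'I_N) (y : N.-tuple T) : n.-tuple T :=
  [tuple tnth y (widen_ord (ltnW (ltn_ord n)) j) | j < n].

Section conditional_distributions.
Context (R : realType) (b N : nat).
Variables (m : 'I_b -> N.-tuple R) (s : R) (n : 'I_N).
Implicit Types y : N.-tuple R.

(* For the first coordinate the prefix is the empty tuple, whose density is 1,
   so that the posterior is uniform. *)
Definition posterior y (i : 'I_b) : R :=
  gauss_pdf (prefix n (m i)) s (prefix n y) /
  \sum_(j < b) gauss_pdf (prefix n (m j)) s (prefix n y).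

Lemma posterior_ge0 y i : 0 <= posterior y i.
Proof.
by rewrite divr_ge0 ?gauss_pdf_ge0// sumr_ge0// => j _; exact: gauss_pdf_ge0.
Qed.

Definition condP y : {finite_measure set (measurableTypeR R) -> \bar R} :=
  mixture (fun i => NngNum (posterior_ge0 y i))
          (fun i => normal_prob (tnth (m i) n) s).

Definition condQ y : {finite_measure set (measurableTypeR R) -> \bar R} :=
  normal_prob 0 s.

End conditional_distributions.

Inductive relation := Remove | Add.

Definition sigmoid (R : realType) (x : R) : R := (1 + expR (- x))^-1.

Lemma sigmoid_ge0 (R : realType) (x : R) : 0 <= sigmoid x.
Proof. by rewrite invr_ge0 addr_ge0 ?expR_ge0. Qed.

Lemma sigmoid_le1 (R : realType) (x : R) : sigmoid x <= 1.
Proof. by rewrite invf_le1 ?ltr_wpDr ?expR_ge0// lerDl expR_ge0. Qed.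

Section procedure.
Context (R : realType) (b N : nat).
Variables (m : 'I_b -> N.-tuple R) (s : R) (n : 'I_N) (beta : R).
Variables (rel : relation) (p : {perm 'I_b}) (tau : 'I_b -> R).

Definition sorts : Prop :=
  forall i j : 'I_b, (i <= j)%N -> tnth (m (p i)) n <= tnth (m (p j)) n.

Definition prefix_mean (j : 'I_b) : n.-tuple R := prefix n (m (p j)).

(* Components are indexed from 0, so the number i - 1 of components preceding
   the i-th one is here the value of the ordinal i. *)
Definition tildeP (i : 'I_b) :
    {finite_measure set (n.-tuple (measurableTypeR R)) -> \bar R} :=
  uniform_mixture
    (fun j : 'I_i => gauss (prefix_mean (widen_ord (ltnW (ltn_ord i)) j)) s).

Definition tildeQ (i : 'I_b) :
    {finite_measure set (n.-tuple (measurableTypeR R)) -> \bar R} :=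
  gauss (prefix_mean i) s.

Definition tildeR :
    {finite_measure set (n.-tuple (measurableTypeR R)) -> \bar R} :=
  match rel with
  | Remove => uniform_mixture (fun k : 'I_b => gauss (prefix_mean k) s)
  | Add => gauss (zero_vec R n) s
  end.

(* tau at index 0 is unconstrained and unused. *)
Definition valid_thresholds : Prop :=
  forall i : 'I_b, (0 < i)%N ->
    (tildeR [set x | lne (('d (charge_of_finite_measure (tildeP i)) '/d
                              (tildeQ i)) x) < (tau i)%:E]
      <= (beta / (b%:R - 1))%:E)%E.

Definition lambda_bar (i : 'I_b) : R :=
  if val i == 0%N then 1 else sigmoid (- ln (val i)%:R - tau i).

Definition weight (i : 'I_b) : R :=
  lambda_bar i * \prod_(j < b | (i < j)%N) (1 - lambda_bar j).

Lemma weight_ge0 i : 0 <= weight i.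
Proof.
have l01 j : 0 <= lambda_bar j <= 1.
  rewrite /lambda_bar; case: ifP => _; first by rewrite ler01 lexx.
  by rewrite sigmoid_ge0 sigmoid_le1.
rewrite mulr_ge0//; first by case/andP: (l01 i).
by apply: prodr_ge0 => j _; rewrite subr_ge0; case/andP: (l01 j).
Qed.

Definition stepP : {finite_measure set (measurableTypeR R) -> \bar R} :=
  mixture (fun j => NngNum (weight_ge0 j))
          (fun j => normal_prob (tnth (m (p j)) n) s).

Definition stepQ : {finite_measure set (measurableTypeR R) -> \bar R} :=
  normal_prob 0 s.

Definition procedure_output :=
  match rel with
  | Remove => (stepP, stepQ)
  | Add => (stepQ, stepP)
  end.

End procedure.

(* Main.v *)
(* The component means being nonnegative, the likelihood ratio of a mixture of
   the N(m_i, s^2) to N(0, s^2) is nondecreasing, so the set on which either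
   hockey-stick divergence is attained is a half-line. The mass that N(m_i, s^2)
   gives to a half-line is monotone in m_i; hence shifting mixture weight towards
   larger means increases both divergences, and it suffices to compare the
   posterior weights with the weights p_i of the procedure. In sorted order both
   are generated backwards by the shares l_i = w_i / (w_1 + ... + w_i), and the
   posterior share is the sigmoid of - log (i - 1) minus the log-ratio thresholded
   by tau_i: it is at most lambda_bar_i unless that ratio falls below tau_i. The
   union bound over i > 1 controls the probability of the exceptional event.
   Measurability of the event that the pair is dominated comes from Fubini-Tonelli
   for each fixed gamma and from Lipschitz continuity in gamma, which reduces the
   quantifier over gamma to the rationals. *)
Require Import Defs.
From HB Require Import structures.
From mathcomp Require Import all_boot all_order all_algebra perm.
From mathcomp Require Import all_classical all_reals all_analysis.
From mathcomp Require Import measurable_realfun ring lra.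
Set Implicit Arguments.
Unset Strict Implicit.
Unset Printing Implicit Defensive.
Import Order.TTheory GRing.Theory Num.Def Num.Theory.
Import numFieldNormedType.Exports.
Local Open Scope classical_set_scope.
Local Open Scope charge_scope.
Local Open Scope ring_scope.

(** * Densities, Radon-Nikodym derivatives and hockey-stick divergences *)

Lemma measurable_funV_gt0 d (T : measurableType d) (R : realType) (f : T -> R) :
  (forall x, 0 < f x) -> measurable_fun setT f ->
  measurable_fun setT (fun x => (f x)^-1).
Proof.
move=> f0 mf; apply: (@measurable_comp _ _ _ _ _ _ [set x : R | x != 0]) => //.
- exact: open_measurable.
- by move=> _ [x _ <-]; exact: lt0r_neq0.
- apply: open_continuous_measurable_fun => //.
  by move=> x; rewrite inE => x0; exact: inv_continuous.
Qed.

Section densities.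
Local Open Scope ereal_scope.
Context d (T : measurableType d) (R : realType).
Implicit Types (mu : {sigma_finite_measure set T -> \bar R}).
Implicit Types (nu P Q : {finite_measure set T -> \bar R}).

(** A real-valued function fixed at every point, so that positivity and monotone ratios can be
    argued pointwise; the Radon-Nikodym derivative is determined only almost everywhere. *)
Definition has_density mu nu (f : T -> R) : Prop :=
  [/\ measurable_fun setT f, forall x, (0 <= f x)%R &
      forall A, measurable A -> nu A = \int[mu]_(x in A) (f x)%:E].

Lemma has_density_dominates mu nu f : has_density mu nu f -> nu `<< mu.
Proof.
move=> [mf f0 nuE]; apply/null_content_dominatesP => A mA muA.
rewrite nuE//; apply: null_set_integral => //.
exact/measurable_funTS/measurable_EFinP.
Qed.

(** The change of variables holds for the Radon-Nikodym derivative, and [f] agrees with it almost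
    everywhere because both have the same integral over every measurable set. *)
Lemma integral_has_density mu nu f (g : T -> \bar R) E :
    has_density mu nu f -> measurable E ->
    measurable_fun setT g -> (forall x, 0 <= g x) ->
  \int[nu]_(x in E) g x = \int[mu]_(x in E) (g x * (f x)%:E).
Proof.
move=> dnu mE mg g0; have numu := has_density_dominates dnu.
have [mf f0 nuE] := dnu.
have mfRN : measurable_fun setT (Radon_Nikodym_SigmaFinite.f nu mu).
  exact: measurable_int (Radon_Nikodym_SigmaFinite.f_integrable _).
rewrite -(Radon_Nikodym_SigmaFinite.change_of_variables numu)//; last first.
  exact: measurable_funTS.
apply: ge0_ae_eq_integral => //.
- by apply: measurable_funTS; exact: emeasurable_funM.
- by apply: measurable_funTS; apply: emeasurable_funM => //; exact/measurable_EFinP.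
- by move=> x _; rewrite mule_ge0// Radon_Nikodym_SigmaFinite.f_ge0.
- by move=> x _; rewrite mule_ge0// lee_fin.
apply: ae_eqe_mul2l; apply: integral_ae_eq => //.
- apply: (integrableS measurableT) => //.
  exact: Radon_Nikodym_SigmaFinite.f_integrable.
- exact/measurable_funTS/measurable_EFinP.
- move=> A AE mA; rewrite -Radon_Nikodym_SigmaFinite.f_integral//.
  exact: nuE.
Qed.

Lemma has_density_Radon_Nikodym mu nu f : has_density mu nu f ->
  ae_eq mu setT ('d (charge_of_finite_measure nu) '/d mu) (EFin \o f).
Proof.
move=> dnu; have numu := has_density_dominates dnu; have [mf f0 nuE] := dnu.
apply: integral_ae_eq => //.
- exact: Radon_Nikodym_integrable.
- exact/measurable_EFinP.
- by move=> A _ mA; rewrite -Radon_Nikodym_integral// -nuE.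
Qed.

Lemma has_density_div mu P Q (p q : T -> R) : (forall x, (0 < p x)%R) ->
  has_density mu P p -> has_density mu Q q ->
  has_density P Q (fun x => q x / p x)%R.
Proof.
move=> p0 dP [mq q0 QE]; have [mp _ _] := dP.
have mqp : measurable_fun setT (fun x => q x / p x)%R.
  by apply: measurable_funM => //; exact: measurable_funV_gt0.
split=> //.
  by move=> x; rewrite divr_ge0// ltW.
move=> A mA; rewrite QE// (integral_has_density dP)//.
- by apply: eq_integral => x _; rewrite -EFinM divfK// gt_eqF.
- exact/measurable_EFinP.
- by move=> x; rewrite lee_fin divr_ge0// ltW.
Qed.

Lemma has_density_mixture (I : finType) mu (w : I -> {nonneg R})
    (P : I -> probability T R) (p : I -> T -> R) :
  (forall i, has_density mu (P i) (p i)) ->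
  has_density mu (mixture w P) (fun x => \sum_i (w i)%:num * p i x)%R.
Proof.
move=> dP; have mp i : measurable_fun setT (p i) by have [] := dP i.
have p0 i x : (0 <= p i x)%R by have [_ + _] := dP i.
split.
- by apply: measurable_sum => i; exact: measurable_funM.
- by move=> x; apply: sumr_ge0 => i _; rewrite mulr_ge0.
- move=> A mA; transitivity (\sum_i (w i)%:num%:E * P i A) => //.
  under [RHS]eq_integral do rewrite -sumEFin.
  rewrite ge0_integral_sum//=.
  + apply: eq_bigr => i _; have [_ _ ->//] := dP i.
    rewrite -ge0_integralZl//.
    * exact/measurable_funTS/measurable_EFinP.
    * by move=> x _; rewrite lee_fin.
  + by move=> i; apply: measurable_funTS; apply/measurable_EFinP; exact: measurable_funM.
  + by move=> i x _; rewrite lee_fin mulr_ge0.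
Qed.

(** The derivative of [Q] with respect to [P] is [q / p] almost everywhere, and the factor [p] from
    the change of measure clears the denominator. *)
Lemma hockey_stick_density mu P Q p q g : (0 <= g)%R ->
    (forall x, (0 < p x)%R) -> has_density mu P p -> has_density mu Q q ->
  hockey_stick g P Q = \int[mu]_x (Num.max (p x - g * q x) 0)%:E.
Proof.
move=> g0 p0 dP dQ; have dQP := has_density_div p0 dP dQ.
have [mqp _ _] := dQP; have [mp _ _] := dP.
rewrite /hockey_stick (ge0_ae_eq_integral (g := fun x =>
    (Num.max (1 - g * (q x / p x)) 0)%:E))//.
- rewrite (integral_has_density dP)//.
  + apply: eq_integral => x _; rewrite -EFinM maxr_pMl 1?ltW// mul0r.
    rewrite mulrBl mul1r -mulrA divfK ?gt_eqF//.
  + apply/measurable_EFinP; apply: measurable_maxr => //.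
    by apply: measurable_funB => //; exact: measurable_funM.
  + by move=> x; rewrite lee_fin le_max lexx orbT.
- apply: measurable_maxe => //; apply: emeasurable_funB => //.
  apply: emeasurable_funM => //.
  apply: measurable_int; apply: Radon_Nikodym_integrable.
  exact: has_density_dominates dQP.
- apply/measurable_EFinP; apply: measurable_maxr => //.
  by apply: measurable_funB => //; exact: measurable_funM.
- by move=> x _; rewrite le_max lexx orbT.
- by move=> x _; rewrite lee_fin le_max lexx orbT.
- have := has_density_Radon_Nikodym dQP; apply: filterS => x /(_ I) ->.
  by rewrite EFin_max.
Qed.

End densities.

(** * Comparison of hockey-stick divergences and measurability of dominance *)

Section hockey_stick_comparison.
Local Open Scope ereal_scope.
Context d (T : measurableType d) (R : realType).
Variable mu : {sigma_finite_measure set T -> \bar R}.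
Implicit Types (P Q : {finite_measure set T -> \bar R}) (p q : T -> R).

Let measurable_excess (g : R) p q : measurable_fun setT p ->
  measurable_fun setT q ->
  measurable_fun setT (fun x => (Num.max (p x - g * q x) 0)%:E).
Proof.
move=> mp mq; apply/measurable_EFinP; apply: measurable_maxr => //.
by apply: measurable_funB => //; exact: measurable_funM.
Qed.

Let excess_ge0 (g : R) p q x : 0 <= (Num.max (p x - g * q x) 0)%:E.
Proof. by rewrite lee_fin le_max lexx orbT. Qed.

Lemma measurable_superlevel (g : R) p q : measurable_fun setT p ->
  measurable_fun setT q -> measurable [set x | (g * q x < p x)%R].
Proof.
move=> mp mq; rewrite -[X in measurable X]setTI.
by apply: measurable_fun_ltr => //; exact: measurable_funM.
Qed.

(* The hockey-stick divergence is the maximum of [P A - g Q A] over measurable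
   [A], attained at the superlevel set below. *)
Lemma hockey_stick_superlevel P Q p q g : (0 <= g)%R ->
    (forall x, (0 < p x)%R) -> has_density mu P p -> has_density mu Q q ->
  let A := [set x | (g * q x < p x)%R] in
  hockey_stick g P Q + g%:E * Q A = P A.
Proof.
move=> g0 p0 dP dQ A; rewrite (hockey_stick_density g0 p0 dP dQ).
have [mp _ PE] := dP; have [mq q0 QE] := dQ.
have mA : measurable A by exact: measurable_superlevel.
rewrite PE// QE// -ge0_integralZl//; last 2 first.
  exact/measurable_funTS/measurable_EFinP.
  by move=> x _; rewrite lee_fin.
rewrite (_ : \int[mu]_x _ =
    \int[mu]_(x in A) (Num.max (p x - g * q x) 0)%:E); last first.
  rewrite [RHS]integral_mkcond; apply: eq_integral => x _.
  rewrite patchE; case: ifPn => // /negP; rewrite inE /A/= => /negP.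
  by rewrite -leNgt => pq; congr EFin; apply/max_idPr; rewrite subr_le0.
rewrite -ge0_integralD//.
- apply: eq_integral => x; rewrite inE /A/= => gqp.
  rewrite -EFinM -EFinD; congr EFin.
  by rewrite (max_idPl _) ?subrK// subr_ge0 ltW.
- exact/measurable_funTS/measurable_excess.
- by move=> x _; rewrite -EFinM lee_fin mulr_ge0.
- apply: measurable_funTS; apply: (@emeasurable_funM _ _ _ _ (cst _)) => //.
  exact/measurable_EFinP.
Qed.

(** The excess is at least [p - g * q] on [A] and nonnegative elsewhere. *)
Lemma hockey_stick_ge P Q p q g A : (0 <= g)%R ->
    (forall x, (0 < p x)%R) -> has_density mu P p -> has_density mu Q q ->
    measurable A ->
  P A <= hockey_stick g P Q + g%:E * Q A.
Proof.
move=> g0 p0 dP dQ mA; rewrite (hockey_stick_density g0 p0 dP dQ).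
have [mp _ PE] := dP; have [mq q0 QE] := dQ.
rewrite PE// QE// -ge0_integralZl//; last 2 first.
  exact/measurable_funTS/measurable_EFinP.
  by move=> x _; rewrite lee_fin.
apply: (@le_trans _ _ (\int[mu]_(x in A) (Num.max (p x - g * q x) 0)%:E +
                       \int[mu]_(x in A) (g%:E * (q x)%:E))); last first.
  rewrite leeD2r//; apply: ge0_subset_integral => //.
  exact: measurable_excess.
have mgq : measurable_fun A (fun x => g%:E * (q x)%:E).
  apply: measurable_funTS; apply: (@emeasurable_funM _ _ _ _ (cst _)) => //.
  exact/measurable_EFinP.
have gq0 x : 0 <= g%:E * (q x)%:E by rewrite -EFinM lee_fin mulr_ge0.
rewrite -ge0_integralD//; last exact/measurable_funTS/measurable_excess.
apply: ge0_le_integral => //.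
- by move=> x _; rewrite lee_fin ltW.
- exact/measurable_funTS/measurable_EFinP.
- apply: emeasurable_funD => //; exact/measurable_funTS/measurable_excess.
- by move=> x _; rewrite -EFinM -EFinD lee_fin -lerBlDr le_max lexx.
Qed.

(** The set attaining the divergence of [P] and [Q] is one competitor in the maximum for [P'] and
    [Q'], so a single test set suffices. Subtracted terms are moved across, and they cancel because
    they are finite. *)
Lemma hockey_stick_le P Q P' Q' p q p' q' g : (0 <= g)%R ->
    (forall x, (0 < p x)%R) -> (forall x, (0 < p' x)%R) ->
    has_density mu P p -> has_density mu Q q ->
    has_density mu P' p' -> has_density mu Q' q' ->
    P [set x | (g * q x < p x)%R] + g%:E * Q' [set x | (g * q x < p x)%R] <=
      P' [set x | (g * q x < p x)%R] + g%:E * Q [set x | (g * q x < p x)%R] ->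
  hockey_stick g P Q <= hockey_stick g P' Q'.
Proof.
move=> g0 p0 p'0 dP dQ dP' dQ'; set A := [set x | _].
have mA : measurable A.
  by apply: measurable_superlevel; [have [] := dP|have [] := dQ].
rewrite -(hockey_stick_superlevel g0 p0 dP dQ) -/A => le1.
have le2 := hockey_stick_ge g0 p'0 dP' dQ' mA.
have fQ : g%:E * Q A \is a fin_num by rewrite fin_numM// fin_num_measure.
have fQ' : g%:E * Q' A \is a fin_num by rewrite fin_numM// fin_num_measure.
rewrite -(leeD2rE _ _ fQ) -(leeD2rE _ _ fQ').
apply: (le_trans le1); rewrite [leRHS]addeAC.
by rewrite leeD2r.
Qed.

(** Pointwise, the two excesses differ by at most [|g - h| * q]. *)
Lemma hockey_stick_lipschitz P Q p q g h : (0 <= g)%R -> (0 <= h)%R ->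
    (forall x, (0 < p x)%R) -> has_density mu P p -> has_density mu Q q ->
  hockey_stick g P Q <= hockey_stick h P Q + `|g - h|%:E * Q setT.
Proof.
move=> g0 h0 p0 dP dQ; rewrite !(hockey_stick_density _ p0 dP dQ)//.
have [mp _ _] := dP; have [mq q0 QE] := dQ.
rewrite QE// -ge0_integralZl//; last 2 first.
  exact/measurable_EFinP.
  by move=> x _; rewrite lee_fin.
have mgq : measurable_fun setT (fun x => `|g - h|%:E * (q x)%:E).
  apply: (@emeasurable_funM _ _ _ _ (cst _)) => //.
  exact/measurable_EFinP.
have gq0 x : 0 <= `|g - h|%:E * (q x)%:E by rewrite -EFinM lee_fin mulr_ge0.
rewrite -ge0_integralD//; last exact: measurable_excess.
apply: ge0_le_integral => //.
- exact: measurable_excess.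
- apply: emeasurable_funD => //; exact: measurable_excess.
- move=> x _; rewrite -EFinM -EFinD lee_fin ge_max; apply/andP; split.
    rewrite -lerBlDr le_max; apply/orP; left.
    rewrite -addrA -opprD lerD2l lerN2.
    rewrite -lerBlDl -mulrBl ler_wpM2r//.
    by rewrite distrC ler_norm.
  by rewrite addr_ge0 ?mulr_ge0// le_max lexx orbT.
Qed.

Lemma measurable_dominates d' (Y : measurableType d')
    (hP hQ : {finite_measure set T -> \bar R}) (hp hq : T -> R)
    (P Q : Y -> {finite_measure set T -> \bar R}) (p q : Y -> T -> R) :
    (forall x, (0 < hp x)%R) -> (forall y x, (0 < p y x)%R) ->
    has_density mu hP hp -> has_density mu hQ hq ->
    (forall y, has_density mu (P y) (p y)) ->
    (forall y, has_density mu (Q y) (q y)) ->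
    measurable_fun setT (fun z : Y * T => p z.1 z.2) ->
    measurable_fun setT (fun z : Y * T => q z.1 z.2) ->
  measurable [set y | dominates (hP, hQ) (P y, Q y)].
Proof.
move=> hp0 p0 dhP dhQ dP dQ mp mq.
(* An enumeration of the rationals; naturals that encode none are sent to 0, which the condition
   [0 < r k] excludes. *)
pose r (k : nat) : R := if unpickle k is Some a then ratr a else 0%R.
rewrite (_ : [set y | _] = \bigcap_(k in [set k | (0 < r k)%R])
   [set y | hockey_stick (r k) (P y) (Q y) <= hockey_stick (r k) hP hQ]).
  apply: bigcap_measurableType => k rk.
  rewrite -[X in measurable X]setTI.
  apply: emeasurable_fun_infty_c => //.
  rewrite (_ : (fun y => _) = (fun y =>
      \int[mu]_x (Num.max (p y x - r k * q y x) 0)%:E)); last first.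
    by apply/funext => y; rewrite (hockey_stick_density _ (p0 y) (dP y) (dQ y))// ltW.
  apply: (measurable_fun_fubini_tonelli_F (fun z : Y * T =>
    (Num.max (p z.1 z.2 - r k * q z.1 z.2) 0)%:E)).
  - apply/measurable_EFinP; apply: measurable_maxr => //.
    by apply: measurable_funB => //; exact: measurable_funM.
  - by move=> z; rewrite lee_fin le_max lexx orbT.
apply/seteqP; split => [y dom k rk|y dom g g0]; first exact: dom.
have fhQ : (fine (hQ setT))%:E = hQ setT by rewrite fineK// fin_num_measure.
have fQ : (fine (Q y setT))%:E = Q y setT by rewrite fineK// fin_num_measure.
set c1 := fine (Q y setT) in fQ; set c2 := fine (hQ setT) in fhQ.
have c10 : (0 <= c1)%R by rewrite -lee_fin fQ.
have c20 : (0 <= c2)%R by rewrite -lee_fin fhQ.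
apply/lee_addgt0Pr => e e0.
have c0 : (0 < c1 + c2 + 1)%R by rewrite ltr_wpDl// addr_ge0.
(* The rational is chosen so close to [g] that the two Lipschitz errors, with constants [c1] and
   [c2], add up to at most [e]; the summand 1 keeps the denominator positive. *)
have [a] : exists a : rat, ratr a \in `]g, g + e / (c1 + c2 + 1)[%R.
  by apply: rat_in_itvoo; rewrite ltrDl divr_gt0.
rewrite in_itv/= => /andP[ga age].
have ra : r (pickle a) = ratr a by rewrite /r pickleK.
have a0 : (0 < ratr a :> R)%R by exact: lt_trans ga.
have := dom (pickle a); rewrite /= ra => /(_ a0) doma.
rewrite /=; apply: le_trans.
  exact: (hockey_stick_lipschitz (ltW g0) (ltW a0) (p0 y) (dP y) (dQ y)).
apply: le_trans.
  apply: leeD2r; apply: (le_trans doma).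
  exact: (hockey_stick_lipschitz (ltW a0) (ltW g0) hp0 dhP dhQ).
rewrite -addeA leeD2l// -fQ -fhQ -!EFinM -EFinD lee_fin.
rewrite (distrC g) -mulrDr (addrC c2) ger0_norm ?subr_ge0 ?(ltW ga)//.
apply: (@le_trans _ _ (e / (c1 + c2 + 1) * (c1 + c2 + 1))%R); last first.
  by rewrite divfK// gt_eqF.
apply: ler_pM; rewrite ?subr_ge0 ?(ltW ga) ?addr_ge0 ?lerDl//.
by rewrite lerBlDl ltW.
Qed.

End hockey_stick_comparison.

(** * Monotone likelihood ratios of normal laws *)

Section normal_likelihood_ratio.
Context (R : realType) (s : R).
Hypothesis s0 : 0 < s.
Implicit Types (m x y : R) (A : set (measurableTypeR R)).

Let sN0 : s != 0. Proof. by rewrite gt_eqF. Qed.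

Lemma normal_pdf_gt0 m x : 0 < normal_pdf m s x.
Proof. by rewrite normal_pdfE//= mulr_gt0 ?normal_peak_gt0 ?expR_gt0. Qed.

Lemma normal_prob_density m :
  has_density (@lebesgue_measure R) (normal_prob m s) (normal_pdf m s).
Proof.
by split => //; [exact: measurable_normal_pdf|exact: normal_pdf_ge0].
Qed.

Lemma le_normal_pdf m1 m2 x :
  (normal_pdf m1 s x <= normal_pdf m2 s x) =
  ((x - m2) ^+ 2 <= (x - m1) ^+ 2).
Proof.
rewrite !normal_pdfE//= ler_pM2l ?normal_peak_gt0// /normal_fun ler_expR.
by rewrite !mulNr lerN2 ler_pM2r// invr_gt0 pmulrn_lgt0// exprn_gt0.
Qed.

(* The likelihood ratio of the two laws crosses 1 at the midpoint of the means,
   so the comparison is pointwise on the upset or on its complement. *)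
Lemma le_normal_prob_upset m1 m2 A : m1 <= m2 -> measurable A ->
    (forall x y, x <= y -> A x -> A y) ->
  (normal_prob m1 s A <= normal_prob m2 s A)%E.
Proof.
move=> m12 mA upA; pose c := (m1 + m2) / 2.
have intle m m' B : measurable B ->
    (forall x, B x -> (x - m') ^+ 2 <= (x - m) ^+ 2) ->
    (normal_prob m s B <= normal_prob m' s B)%E.
  move=> mB le; rewrite /normal_prob; apply: ge0_le_integral => //.
  - by move=> x _; rewrite lee_fin normal_pdf_ge0.
  - apply/measurable_funTS/measurable_EFinP; exact: measurable_normal_pdf.
  - apply/measurable_funTS/measurable_EFinP; exact: measurable_normal_pdf.
  - by move=> x Bx; rewrite lee_fin le_normal_pdf le.
have [sub|/existsNP[x /not_implyP[Ax /negP]]] :=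
    pselect (forall x, A x -> c <= x).
  apply: intle => // x /sub; rewrite /c => cx; nra.
rewrite -ltNge => xc.
have {}upA z : (~` A) z -> z <= c.
  move=> nAz; rewrite leNgt; apply/negP => cz; apply: nAz.
  by apply: upA Ax; rewrite ltW// (lt_trans xc).
have mCA : measurable (~` A) by exact: measurableC.
rewrite -(setCK A) !(probability_setC (normal_prob _ s) mCA).
apply: leeD2l; rewrite leeN2; apply: (intle _ _ _ mCA) => z /upA; rewrite /c => zc; nra.
Qed.

Lemma le_normal_prob_downset m1 m2 A : m1 <= m2 -> measurable A ->
    (forall x y, x <= y -> A y -> A x) ->
  (normal_prob m2 s A <= normal_prob m1 s A)%E.
Proof.
move=> m12 mA downA; have mCA : measurable (~` A) by exact: measurableC.
rewrite -(setCK A) !(probability_setC (normal_prob _ s) mCA).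
apply: leeD2l; rewrite leeN2.
apply: (le_normal_prob_upset m12 mCA) => x y xy nAx Ay.
by apply: nAx; exact: downA Ay.
Qed.

(** The two exponents differ by a positive multiple of [m * (y - x)]; this is where nonnegative
    means matter. The ratio is cross-multiplied to avoid division. *)
Lemma normal_pdf_monotone_ratio m x y : 0 <= m -> x <= y ->
  normal_pdf m s x * normal_pdf 0 s y <= normal_pdf m s y * normal_pdf 0 s x.
Proof.
move=> m0 xy; rewrite !normal_pdfE//= /normal_fun mulrACA [leRHS]mulrACA.
rewrite ler_pM2l ?mulr_gt0 ?normal_peak_gt0// -!expRD ler_expR -!mulrDl.
by rewrite ler_pM2r ?invr_gt0 ?pmulrn_lgt0 ?exprn_gt0//; nra.
Qed.

Context (I : finType) (w m : I -> R).
Hypotheses (w0 : forall i, 0 <= w i) (m0 : forall i, 0 <= m i).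
Let mix x := \sum_i w i * normal_pdf (m i) s x.

Lemma mixture_pdf_monotone_ratio x y : x <= y ->
  mix x * normal_pdf 0 s y <= mix y * normal_pdf 0 s x.
Proof.
move=> xy; rewrite !mulr_suml; apply: ler_sum => i _.
by rewrite -!mulrA ler_wpM2l// normal_pdf_monotone_ratio.
Qed.

(** Together with [mixture_sublevel_downset], this gives the shape of the test sets for
    [hockey_stick_le]: an upset for removal, a downset for addition. *)
Lemma mixture_superlevel_upset g x y : x <= y ->
  g * normal_pdf 0 s x < mix x -> g * normal_pdf 0 s y < mix y.
Proof.
move=> xy lt; rewrite -(ltr_pM2r (normal_pdf_gt0 0 x)).
apply: lt_le_trans (mixture_pdf_monotone_ratio xy).
by rewrite mulrAC ltr_pM2r// normal_pdf_gt0.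
Qed.

Lemma mixture_sublevel_downset g x y : 0 <= g -> x <= y ->
  g * mix y < normal_pdf 0 s y -> g * mix x < normal_pdf 0 s x.
Proof.
move=> g0 xy lt; rewrite -(ltr_pM2r (normal_pdf_gt0 0 y)).
rewrite -mulrA; apply: le_lt_trans.
  by apply: (ler_wpM2l g0); exact: mixture_pdf_monotone_ratio xy.
by rewrite mulrA [ltLHS]mulrC ltr_pM2l// normal_pdf_gt0.
Qed.

End normal_likelihood_ratio.

(** * Weights generated backwards from shares, and their means *)

Section backward_weights.
Context {R : realFieldType}.

(** Indexed by naturals rather than ordinals, so that induction on the number of components does not
    change the type of [lam] and [a]. *)
Let backward_mean (lam a : nat -> R) b :=
  \sum_(0 <= i < b) lam i * \prod_(i.+1 <= j < b) (1 - lam j) * a i.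

Let backward_meanS lam a b : backward_mean lam a b.+1 =
  (1 - lam b) * backward_mean lam a b + lam b * a b.
Proof.
rewrite /backward_mean big_nat_recr//= (@big_geq _ _ _ b.+1)// mulr1; congr +%R.
rewrite big_distrr; apply: eq_big_nat => i /andP[_ ib] /=.
by rewrite big_nat_recr//=; ring.
Qed.

(** The second conjunct strengthens the induction: with the mean so far below the next value of [a],
    a larger share for that value can only raise the mean. *)
Let le_backward_mean_nat b (f lam a : nat -> R) :
    lam 0%N = 1 -> (forall k, (k <= b)%N -> 0 <= lam k <= 1) ->
    (forall k, (k <= b)%N -> 0 <= f k) ->
    (forall k, (k <= b)%N ->
      f k <= lam k * (\sum_(0 <= j < k) f j + f k)) ->
    (forall k, (k < b)%N -> a k <= a k.+1) ->
  (\sum_(0 <= i < b.+1) f i * a i <=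
   (\sum_(0 <= i < b.+1) f i) * backward_mean lam a b.+1) /\
  backward_mean lam a b.+1 <= a b.
Proof.
move=> lam0; elim: b => [|b IHb] lam01 f0 flam amono.
  rewrite backward_meanS !big_nat1 lam0 subrr mul0r add0r mul1r.
  by split.
have [||||le1 le2] := IHb.
- by move=> k kb; apply: lam01; rewrite leqW.
- by move=> k kb; apply: f0; rewrite leqW.
- by move=> k kb; apply: flam; rewrite leqW.
- by move=> k kb; apply: amono; rewrite leqW.
have ab := amono b (leqnn _).
have /andP[l0 l1] := lam01 b.+1 (leqnn _).
have fb := f0 b.+1 (leqnn _); have flb := flam b.+1 (leqnn _).
rewrite backward_meanS !(big_nat_recr b.+1)//=.
set F := \sum_(0 <= i < b.+1) f i in le1 flb *.
set S := \sum_(0 <= i < b.+1) _ in le1 *.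
set U := backward_mean lam a b.+1 in le1 le2 *.
(* The gap in the first inequality is at least [(a b.+1 - U) * (lam b.+1 * (F + f b.+1) - f b.+1)],
   a product of two nonnegative factors. *)
by split; nra.
Qed.

Context (b : nat).
Implicit Types f lam a : 'I_b -> R.

(* A convex combination with weights proportional to [f] is a mean computed
   recursively: [M_i = (1 - l_i) M_(i-1) + l_i a_i], where [l_i] is the share of
   [f i] among [f 0, ..., f i]. As [a] is nondecreasing, [M_(i-1) <= a_i], so
   each step is nondecreasing both in [M_(i-1)] and in [l_i]. *)
Lemma le_backward_mean f lam a :
    (forall i, val i = 0%N -> lam i = 1) -> (forall i, 0 <= lam i <= 1) ->
    (forall i, 0 <= f i) ->
    (forall i, f i <= lam i * (\sum_(j < b | (j < i)%N) f j + f i)) ->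
    (forall i j : 'I_b, (i <= j)%N -> a i <= a j) ->
  \sum_i f i * a i <=
  (\sum_i f i) * \sum_i lam i * \prod_(j < b | (i < j)%N) (1 - lam j) * a i.
Proof.
case: b f lam a => [|n] f lam a lam0 lam01 f0 flam amono.
  by rewrite !big_ord0 mulr0.
have [|k _|k _|k kn|k kn|le _] := @le_backward_mean_nat n
    (fun k => f (inord k)) (fun k => lam (inord k)) (fun k => a (inord k)).
- by apply: lam0; rewrite /= inordK.
- exact: lam01.
- exact: f0.
- rewrite big_mkord (big_ord_widen n.+1 (fun j => f (inord j))) 1?leqW//.
  have := flam (inord k); rewrite inordK//.
  by under [X in _ -> _ <= _ * (X + _)]eq_bigr do rewrite inord_val.
- by apply: amono; rewrite !inordK// ltnW.
- move: le; rewrite /backward_mean !big_mkord.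
  under eq_bigr do rewrite inord_val.
  under [X in _ <= X * _ -> _]eq_bigr do rewrite inord_val.
  under [X in _ <= _ * X -> _]eq_bigr => i _.
    rewrite inord_val big_geq_mkord.
    under eq_bigr do rewrite inord_val.
    over.
  by [].
Qed.

(** The total is the backward mean of the constant 1; it starts at 1 because the first share is 1,
    and each step is a convex combination. *)
Lemma sum_backward_weights lam : (0 < b)%N ->
    (forall i, val i = 0%N -> lam i = 1) ->
  \sum_i lam i * \prod_(j < b | (i < j)%N) (1 - lam j) = 1.
Proof.
case: b lam => // n lam _ lam0.
have mean1 k : backward_mean (fun k => lam (inord k)) (fun=> 1) k.+1 = 1.
  elim: k => [|k IHk]; rewrite backward_meanS.
    by rewrite /= lam0 /= ?inordK//; ring.
  by rewrite IHk !mulr1 subrK.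
rewrite -[RHS](mean1 n) /backward_mean big_mkord; apply: eq_bigr => i _.
rewrite inord_val mulr1 big_geq_mkord.
by under [in RHS]eq_bigr do rewrite inord_val.
Qed.

End backward_weights.

(** * Product laws: marginals and densities *)

Lemma measurable_prefix_widen d (T : measurableType d) n k (le_nk : (n <= k)%N) :
  measurable_fun setT (fun y : k.-tuple T =>
    [tuple tnth y (widen_ord le_nk j) | j < n] : n.-tuple T).
Proof.
apply/measurable_fun_tnthP => j; rewrite /comp.
under eq_fun do rewrite tnth_mktuple.
exact: measurable_tnth.
Qed.

Section product_laws.
Local Open Scope ereal_scope.
Context d (T : measurableType d) (R : realType).

Lemma integral_product_lawS k (P : 'I_k.+1 -> probability T R)
    (g : k.+1.-tuple T -> \bar R) :
  measurable_fun setT g -> (forall x, 0 <= g x) ->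
  \int[product_law P]_x g x =
  \int[P ord0]_x \int[product_law (fun i => P (lift ord0 i))]_z
    g (tuple_cons (x, z)).
Proof.
move=> mg g0 /=; rewrite ge0_integral_distribution//.
rewrite fubini_tonelli1//=.
exact: measurableT_comp mg (@measurable_tuple_cons _ _ _).
Qed.

(** Stated for integrals because, once the first coordinate is fixed, the induction hypothesis is
    applied to a function of the tail. The coordinates beyond [n] disappear in the base case, where
    both laws have mass 1. *)
Lemma integral_product_law_widen n k (le_nk : (n <= k)%N)
    (P : 'I_k -> probability T R) (g : n.-tuple T -> \bar R) :
  measurable_fun setT g -> (forall x, 0 <= g x) ->
  \int[product_law P]_y g [tuple tnth y (widen_ord le_nk j) | j < n] =
  \int[product_law (fun j => P (widen_ord le_nk j))]_x g x.
Proof.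
elim: n k le_nk P g => [|n IHn] k le_nk P g mg g0.
  under [LHS]eq_integral do rewrite [X in g X]tuple0.
  under [RHS]eq_integral do rewrite [X in g X]tuple0.
  rewrite !integral_cst//; congr (_ * _).
  by transitivity (1 : \bar R); [exact: probability_setT|exact/esym/probability_setT].
case: k le_nk P => // k le_nk P.
have mg' : measurable_fun setT
    (fun y => g [tuple tnth y (widen_ord le_nk j) | j < n.+1]).
  exact: measurableT_comp mg (measurable_prefix_widen _).
rewrite !integral_product_lawS//.
rewrite (_ : widen_ord le_nk ord0 = ord0); last exact: val_inj.
have le_nk' : (n <= k)%N by [].
have -> : (fun i => P (widen_ord le_nk (lift ord0 i))) =
    (fun i => P (lift ord0 (widen_ord le_nk' i))).
  by apply/funext => i; congr P; exact: val_inj.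
apply: eq_integral => x _.
rewrite -(IHn _ le_nk' (fun i => P (lift ord0 i)) (fun z => g (tuple_cons (x, z))))//.
  apply: eq_integral => z _; congr g; apply: eq_from_tnth => j.
  rewrite tnth_mktuple; have [j' ->|->] := unliftP ord0 j.
    rewrite (_ : widen_ord _ _ = lift ord0 (widen_ord le_nk' j')).
      by rewrite !tnthS tnth_mktuple.
    exact: val_inj.
  rewrite (_ : widen_ord le_nk ord0 = ord0) ?tnth0//.
  exact: val_inj.
apply: measurableT_comp mg _.
exact: measurableT_comp (@measurable_tuple_cons _ _ _) (measurable_pair1 x).
Qed.

Lemma product_law_widen n k (le_nk : (n <= k)%N)
    (P : 'I_k -> probability T R) (B : set (n.-tuple T)) : measurable B ->
  product_law P [set y | B [tuple tnth y (widen_ord le_nk j) | j < n]] =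
  product_law (fun j => P (widen_ord le_nk j)) B.
Proof.
move=> mB; have mpB : measurable
    [set y : k.-tuple T | B [tuple tnth y (widen_ord le_nk j) | j < n]].
  rewrite -[X in measurable X]setTI.
  exact: (measurable_prefix_widen le_nk).
transitivity (\int[product_law P]_y
    (\1_[set y | B [tuple tnth y (widen_ord le_nk j) | j < n]] y)%:E).
  by rewrite integral_indic// setIT.
transitivity (\int[product_law (fun j => P (widen_ord le_nk j))]_x (\1_B x)%:E).
  rewrite -integral_product_law_widen//.
  exact/measurable_EFinP/measurable_indic.
by rewrite integral_indic// setIT.
Qed.

(** The reference measure is itself a product law, so the likelihood ratio of two Gaussian vectors
    is obtained directly from those of their coordinates. *)
Lemma product_law_density k (P' P : 'I_k -> probability T R)
    (f : 'I_k -> T -> R) : (forall i, has_density (P' i) (P i) (f i)) ->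
  has_density (product_law P') (product_law P)
    (fun x => \prod_i f i (tnth x i))%R.
Proof.
elim: k P' P f => [|k IHk] P' P f dP.
  split.
  - rewrite (_ : (fun _ => _) = cst 1%R); first exact: measurable_cst.
    by apply/funext => x; rewrite big_ord0.
  - by move=> x; rewrite big_ord0.
  - move=> A mA; under eq_integral do rewrite big_ord0.
    by rewrite integral_cst// mul1e.
have {IHk} dPk := IHk _ _ _ (fun i => dP (lift ord0 i)).
have [mf0 f00 _] := dP ord0; have [mfk fk0 _] := dPk.
have mf i : measurable_fun setT (f i) by have [] := dP i.
have f0 i x : (0 <= f i x)%R by have [] := dP i.
have mpf : measurable_fun setT (fun x : k.+1.-tuple T =>
    \prod_i f i (tnth x i))%R.
  apply: measurable_prod => i _.
  exact: (measurableT_comp (mf i) (@measurable_tnth _ _ _ _)).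
have pf0 (x : k.+1.-tuple T) : (0 <= \prod_i f i (tnth x i))%R.
  by apply: prodr_ge0.
split=> // A mA.
have m1A : measurable_fun setT (fun x => (\1_A x : R)%:E).
  exact/measurable_EFinP/measurable_indic.
(* Both sides become integrals over the whole space, so that the first coordinate can be split
   off. *)
rewrite -[LHS](_ : \int[product_law P]_x (\1_A x)%:E = _); last first.
  by rewrite integral_indic// setIT.
rewrite [RHS]integral_mkcond.
rewrite (_ : \int[product_law P']_x _ = \int[product_law P']_x
    ((\1_A x)%:E * (\prod_i f i (tnth x i))%:E)); last first.
  by apply: eq_integral => x _; rewrite epatch_indic /= muleC.
rewrite !integral_product_lawS//; last 2 first.
- by apply: emeasurable_funM => //; exact/measurable_EFinP.
- by move=> x; rewrite mule_ge0// lee_fin.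
(* The integrand once the density of the tail is inserted; only the factor [f ord0] of the first
   coordinate is missing. *)
set G := fun (z : T * k.-tuple T) => (\1_A (tuple_cons z) : R)%:E *
  (\prod_i f (lift ord0 i) (tnth z.2 i))%:E.
have m1Ac : measurable_fun setT
    (fun z : T * k.-tuple T => (\1_A (tuple_cons z) : R)%:E).
  exact: measurableT_comp m1A (@measurable_tuple_cons _ _ _).
have mG : measurable_fun setT G.
  apply: emeasurable_funM => //; apply/measurable_EFinP.
  exact: measurableT_comp mfk measurable_snd.
have G0 z : 0 <= G z by rewrite /G mule_ge0// lee_fin.
transitivity (\int[P ord0]_x
    \int[product_law (fun i => P' (lift ord0 i))]_z G (x, z)).
  apply: eq_integral => x _; rewrite (integral_has_density dPk)//.
  exact: measurableT_comp m1Ac (measurable_pair1 x).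
have mFG := measurable_fun_fubini_tonelli_F
  (m2 := product_law (fun i => P' (lift ord0 i))) G mG G0.
rewrite (integral_has_density (dP ord0))//; last first.
  by move=> x; apply: integral_ge0 => z _.
apply: eq_integral => x _; rewrite -ge0_integralZr//.
- apply: eq_integral => z _; rewrite /G -!muleA; congr (_ * _).
  rewrite -EFinM; congr EFin; rewrite big_ord_recl mulrC; congr (_ * _)%R.
  by apply: eq_bigr => i _; rewrite tnthS.
- exact: measurableT_comp mG (measurable_pair1 x).
- by rewrite lee_fin.
Qed.

End product_laws.

(** * Gaussian vectors *)

Section gaussian_laws.
Context (R : realType) (s : R).
Hypothesis s0 : 0 < s.

(** Links the closed formula used by the posterior with the product law [gauss]. *)
Lemma gauss_pdfE k (m x : k.-tuple R) :
  gauss_pdf m s x = \prod_i normal_pdf (tnth m i) s (tnth x i).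
Proof.
rewrite /gauss_pdf; under [RHS]eq_bigr do rewrite normal_pdfE ?gt_eqF//.
rewrite big_split/= prodr_const card_ord /normal_peak /normal_fun.
rewrite exprVn; congr (_^-1 * _).
  elim: k {m x} => [|k IHk]; first by rewrite !expr0 sqrtr1.
  rewrite (exprS (s ^+ 2 * pi *+ 2)) sqrtrM; last first.
    by rewrite mulrn_wge0// mulr_ge0 ?sqr_ge0 ?pi_ge0.
  by rewrite IHk -exprS.
rewrite -expR_sum; congr expR; rewrite mulNr mulr_suml -sumrN.
by apply: eq_bigr => i _; rewrite mulNr.
Qed.

Lemma gauss_pdf_gt0 k (m x : k.-tuple R) : 0 < gauss_pdf m s x.
Proof. by rewrite gauss_pdfE prodr_gt0// => i _; exact: normal_pdf_gt0. Qed.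

Lemma gauss_density k (m m' : k.-tuple R) :
  has_density (gauss m' s) (gauss m s)
    (fun x => gauss_pdf m s x / gauss_pdf m' s x).
Proof.
rewrite (_ : (fun x => _) = (fun x : k.-tuple R => \prod_i
    (normal_pdf (tnth m i) s (tnth x i) / normal_pdf (tnth m' i) s (tnth x i)))).
  apply: (@product_law_density _ (measurableTypeR R) R k
    (fun i => normal_prob (tnth m' i) s) (fun i => normal_prob (tnth m i) s)
    (fun i y => normal_pdf (tnth m i) s y / normal_pdf (tnth m' i) s y)) => i.
  apply: has_density_div.
  - by move=> x; exact: normal_pdf_gt0.
  - exact: normal_prob_density.
  - exact: normal_prob_density.
by apply/funext => x; rewrite !gauss_pdfE -prodf_div.
Qed.

Lemma measurable_gauss_pdf k (m : k.-tuple R) :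
  measurable_fun setT (gauss_pdf m s : k.-tuple (measurableTypeR R) -> R).
Proof.
rewrite (_ : gauss_pdf m s = fun x : k.-tuple R =>
    \prod_i normal_pdf (tnth m i) s (tnth x i)); last first.
  by apply/funext => x; exact: gauss_pdfE.
apply: measurable_prod => i _.
apply: (measurableT_comp (measurable_normal_pdf _ _)).
exact: measurable_tnth.
Qed.

Lemma measurable_prefix N (n : 'I_N) :
  measurable_fun setT (Defs.prefix n : N.-tuple (measurableTypeR R) -> _).
Proof. exact: measurable_prefix_widen. Qed.

(** Transfers threshold probabilities, which concern tuples of length [n], to the law of the full
    vector. *)
Lemma gauss_prefix N (n : 'I_N) (m : N.-tuple R)
    (B : set (n.-tuple (measurableTypeR R))) : measurable B ->
  gauss m s (Defs.prefix n @^-1` B) = gauss (Defs.prefix n m) s B.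
Proof.
move=> mB; transitivity (product_law
    (fun i => normal_prob (tnth m (widen_ord (ltnW (ltn_ord n)) i)) s) B).
  exact: product_law_widen.
congr (product_law _ B); apply/funext => i.
by rewrite tnth_mktuple.
Qed.

End gaussian_laws.

(** * The union bound and log-ratio thresholds *)

Section union_bound.
Local Open Scope ereal_scope.
Context d (T : measurableType d) (R : realType).

Lemma union_bound (mu : {finite_measure set T -> \bar R}) b (P : pred 'I_b)
    (B : 'I_b -> set T) (D : set T) (c : R) :
    mu setT = 1 -> (forall i, measurable (B i)) -> measurable D ->
    (forall i, P i -> mu (B i) <= c%:E) ->
    (forall y, (forall i, P i -> ~ B i y) -> D y) ->
  (1 - (#|P|%:R * c)%R%:E <= mu D).
Proof.
move=> mu1 mB mD muB BD.
have mCD : measurable (~` D) by exact: measurableC.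
have [fD fCD] : mu D \is a fin_num /\ mu (~` D) \is a fin_num.
  by split; rewrite fin_num_measure.
have -> : mu D = 1 - mu (~` D).
  rewrite -mu1 -(setvU D) measureU//; last exact: setICl.
  by rewrite addeAC subee// add0e.
rewrite leeB//.
(* The exceptional sets are extended to a sequence by the empty set, the form in which subadditivity
   is applied. *)
pose C k := if insub k is Some i then if P i then B i else set0 else set0.
have CE (i : 'I_b) : C i = if P i then B i else set0 by rewrite /C valK.
have mC k : measurable (C k).
  by rewrite /C; case: insub => // i; case: ifP.
have le : mu (~` D) <= \sum_(k < b) mu (C k).
  apply: content_subadditive => // y Dy.
  have [i Bi] : exists i, P i /\ B i y.
    apply: contrapT => nB; apply: Dy; apply: BD => i Pi Bi.
    by apply: nB; exists i.
  rewrite -bigcup_mkord; exists i => //=.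
  by rewrite CE (proj1 Bi); exact: (proj2 Bi).
apply: (le_trans le); under eq_bigr do rewrite CE.
rewrite (bigID P)/= [X in _ + X]big1 ?adde0; last first.
  by move=> i /negbTE ->; rewrite measure0.
apply: (@le_trans _ _ (\sum_(i | P i) c%:E)).
  by apply: lee_sum => i Pi; rewrite Pi muB.
by rewrite sumEFin sumr_const mulr_natl.
Qed.

(** At nonpositive reals [lne] is [-oo] and both sides are true, so exponentiating is an equivalence
    on all of [\bar R]. *)
Lemma lne_lt_EFin (x : \bar R) (t : R) :
  (lne x < t%:E) = (x < (expR t)%:E).
Proof.
case: x => [r| |] /=; [|by []|by rewrite !ltNyr].
case: ifPn => [r0|]; rewrite ?lte_fin.
  by rewrite ltNyr (le_lt_trans r0)// expR_gt0.
rewrite -ltNge => r0.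
by rewrite -[X in _ = (X < _)%R](lnK r0) ltr_expR.
Qed.

(** The derivative and its explicit version [f] differ only on a [Q]-null set, which is [mu]-null by
    absolute continuity. *)
Lemma measure_lne_Radon_Nikodym (mu : {finite_measure set T -> \bar R})
    (P Q : {finite_measure set T -> \bar R}) f (t : R) :
    has_density Q P f -> mu `<< Q ->
  mu [set x | (f x < expR t)%R] <=
  mu [set x | lne (('d (charge_of_finite_measure P) '/d Q) x) < t%:E].
Proof.
move=> dP muQ; have [mf _ _] := dP.
have PQ := has_density_dominates dP.
set h := 'd _ '/d _.
have mh : measurable_fun setT h.
  rewrite /h; apply: measurable_int; apply: Radon_Nikodym_integrable; exact: PQ.
rewrite (_ : [set x | lne (h x) < t%:E] = [set x | h x < (expR t)%:E]); last first.
  by apply/seteqP; split => x /=; rewrite lne_lt_EFin.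
set A := [set x | _]; set A' := [set x | _ < _].
have mA : measurable A.
  rewrite -[A]setTI.
  exact: (measurable_fun_ltr mf (@measurable_cst _ _ _ _ setT (expR t))).
have mA' : measurable A'.
  by rewrite -[A']setTI; exact: emeasurable_fun_infty_o.
have mAA' : measurable (A `\` A') by exact: measurableD.
have null : mu (A `\` A') = 0.
  move/null_content_dominatesP : muQ; apply => //.
  apply: measure_negligible => //.
  apply: negligibleS (has_density_Radon_Nikodym dP) => x /= [Ax nA'x] hx.
  by apply: nA'x; rewrite /A' /= /h hx//= lte_fin.
apply: (@le_trans _ _ (mu (A' `|` (A `\` A')))).
  apply: le_measure; rewrite ?inE//; first exact: measurableU.
  by move=> x Ax; have [?|?] := pselect (A' x); [left|right].
have : mu (A' `|` (A `\` A')) <= mu A' + mu (A `\` A') by exact: measureU2.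
by rewrite null adde0.
Qed.

End union_bound.

(** * Correctness of the procedure *)

Section procedure_correctness.
Context (R : realType) (b N : nat) (s : R) (m : 'I_b -> N.-tuple R) (n : 'I_N).
Context (p : {perm 'I_b}) (tau : 'I_b -> R).
Hypotheses (b0 : (0 < b)%N) (s0 : 0 < s).
Implicit Types (y : N.-tuple R) (a : 'I_b -> R).

Let pm := prefix_mean m n p.

(** An everywhere defined version of the derivative of [tildeP] with respect to [tildeQ]. *)
Definition likelihood_ratio (i : 'I_b) (x : n.-tuple R) : R :=
  \sum_(j < i) i%:R^-1 *
    (gauss_pdf (pm (widen_ord (ltnW (ltn_ord i)) j)) s x / gauss_pdf (pm i) s x).

Lemma likelihood_ratio_density i :
  has_density (tildeQ m s n p i) (tildeP m s n p i) (likelihood_ratio i).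
Proof. by apply: has_density_mixture => j; exact: gauss_density. Qed.

Lemma sum_weight : \sum_i weight tau i = 1.
Proof. by apply: sum_backward_weights => // i i0; rewrite /lambda_bar i0. Qed.

Lemma posterior_sum y : \sum_i posterior m s n y i = 1.
Proof.
rewrite -mulr_suml divff// gt_eqF//.
rewrite (bigD1 (Ordinal b0))//= ltr_wpDr ?gauss_pdf_gt0//.
by apply: sumr_ge0 => i _; exact: gauss_pdf_ge0.
Qed.

(** The good event: none of the exceptional events of the union bound occurs. *)
Definition above_thresholds y : Prop :=
  forall i : 'I_b, (0 < i)%N ->
    ~ likelihood_ratio i (Defs.prefix n y) < expR (tau i).

Let likelihood y j := gauss_pdf (pm j) s (Defs.prefix n y).

(** For positive [i], [lambda_bar tau i] equals [1 / (1 + i * expR (tau i))], and the threshold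
    condition says that [i * expR (tau i) * likelihood y i] is at most the sum of the earlier
    likelihoods. *)
Lemma le_lambda_bar y i : above_thresholds y ->
  likelihood y i <=
  lambda_bar tau i * (\sum_(j < b | (j < i)%N) likelihood y j + likelihood y i).
Proof.
move=> good; set f := likelihood y; have f0 j : 0 < f j by exact: gauss_pdf_gt0.
rewrite /lambda_bar; have [i0|i0] := eqVneq (val i) 0%N.
  by rewrite mul1r lerDr sumr_ge0// => j _; exact: ltW.
have ipos : (0 < i)%N by rewrite lt0n.
have iR : 0 < (val i)%:R :> R by rewrite ltr0n.
have /negP := good i ipos; rewrite -leNgt /likelihood_ratio -mulr_sumr.
rewrite -mulr_suml -/(f i) big_ord_narrow ?(ltnW (ltn_ord i))// => le_i.
rewrite (eq_irrelevance le_i (ltnW (ltn_ord i))) {le_i}.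
set S := \sum_(j < i) _ => le.
have {}le : (val i)%:R * expR (tau i) * f i <= S.
  by rewrite -ler_pdivlMr// -ler_pdivlMl.
rewrite /sigmoid opprB opprK addrC expRD lnK ?posrE//.
rewrite mulrC ler_pdivlMr; last by rewrite addr_gt0// mulr_gt0// expR_gt0.
by rewrite mulrDr mulr1 lerD2r mulrC [expR _ * _]mulrC.
Qed.

(** Stochastic dominance of the procedure's weights over the sorted posterior, tested against any
    nondecreasing [a]; below, [a] is the mass each component gives to an upset, or minus its mass on
    a downset. *)
Lemma posterior_mean_le y a : above_thresholds y ->
    (forall i j : 'I_b, (i <= j)%N -> a i <= a j) ->
  \sum_i posterior m s n y (p i) * a i <= \sum_i weight tau i * a i.
Proof.
move=> good amono; pose f := likelihood y.
have f0 j : 0 < f j by exact: gauss_pdf_gt0.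
have F0 : 0 < \sum_i f i.
  rewrite (bigD1 (Ordinal b0))//= ltr_wpDr//.
  by apply: sumr_ge0 => i _; exact: ltW.
have FE : \sum_j gauss_pdf (Defs.prefix n (m j)) s (Defs.prefix n y) = \sum_i f i.
  by rewrite (reindex_inj (@perm_inj _ p)).
rewrite [leLHS](_ : _ = (\sum_i f i * a i) / \sum_i f i); last first.
  rewrite mulr_suml; apply: eq_bigr => i _.
  by rewrite /posterior FE mulrAC.
rewrite ler_pdivrMr// [leRHS]mulrC.
apply: (@le_backward_mean R b f (lambda_bar tau) a) => //.
- by move=> i i0; rewrite /lambda_bar i0.
- move=> i; rewrite /lambda_bar; case: ifP => _; first by rewrite ler01 lexx.
  by rewrite sigmoid_ge0 sigmoid_le1.
- by move=> i; exact: ltW.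
- by move=> i; exact: le_lambda_bar.
Qed.

Let nu i : probability (measurableTypeR R) R := normal_prob (tnth (m (p i)) n) s.

Let nuE i A : measurable A -> nu i A = (fine (nu i A))%:E.
Proof. by move=> mA; rewrite fineK// fin_num_measure. Qed.

Let condPE y A : measurable A -> condP m s n y A =
  (\sum_i posterior m s n y (p i) * fine (nu i A))%:E.
Proof.
move=> mA; rewrite -sumEFin.
transitivity (\sum_i (posterior m s n y i)%:E *
  normal_prob (tnth (m i) n) s A)%E => //.
rewrite (reindex_inj (@perm_inj _ p)); apply: eq_bigr => i _.
by rewrite [RHS]EFinM -nuE.
Qed.

Let stepPE A : measurable A -> stepP m s n p tau A =
  (\sum_i weight tau i * fine (nu i A))%:E.
Proof.
move=> mA; rewrite -sumEFin.
transitivity (\sum_i (weight tau i)%:E * nu i A)%E => //.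
by apply: eq_bigr => i _; rewrite [RHS]EFinM -nuE.
Qed.

Hypothesis sorted_p : sorts m n p.

Lemma condP_le_stepP_upset y A : above_thresholds y -> measurable A ->
    (forall u v : R, u <= v -> A u -> A v) ->
  (condP m s n y A <= stepP m s n p tau A)%E.
Proof.
move=> good mA upA; rewrite condPE// stepPE// lee_fin.
apply: (posterior_mean_le good) => i j ij.
rewrite -lee_fin -(nuE i mA) -(nuE j mA).
exact: (le_normal_prob_upset s0 (sorted_p ij) mA upA).
Qed.

Lemma stepP_le_condP_downset y A : above_thresholds y -> measurable A ->
    (forall u v : R, u <= v -> A v -> A u) ->
  (stepP m s n p tau A <= condP m s n y A)%E.
Proof.
(* The masses of a downset decrease along the sorted order, so the comparison is applied to their
   negatives. *)
move=> good mA downA; rewrite condPE// stepPE// lee_fin -lerN2 -!sumrN.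
under eq_bigr do rewrite -mulrN; under [leRHS]eq_bigr do rewrite -mulrN.
apply: (posterior_mean_le good) => i j ij; rewrite lerN2.
rewrite -lee_fin -(nuE i mA) -(nuE j mA).
exact: (le_normal_prob_downset s0 (sorted_p ij) mA downA).
Qed.

Let cond_pdf y x :=
  \sum_i posterior m s n y i * normal_pdf (tnth (m i) n) s x.
Let step_pdf x :=
  \sum_i weight tau i * normal_pdf (tnth (m (p i)) n) s x.
Let base_pdf x := normal_pdf 0 s x.

Let mixture_pdf_gt0 (w c : 'I_b -> R) x : (forall i, 0 <= w i) ->
  \sum_i w i = 1 -> 0 < \sum_i w i * normal_pdf (c i) s x.
Proof.
move=> w0 w1; have [i wi] : exists i, 0 < w i.
  apply: contrapT => nw; have : \sum_i w i = 0.
    apply: big1 => i _; apply/eqP; rewrite eq_le w0 andbT leNgt.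
    by apply/negP => wi; apply: nw; exists i.
  by rewrite w1 => /eqP; rewrite oner_eq0.
rewrite (bigD1 i)//= ltr_wpDr ?mulr_gt0 ?normal_pdf_gt0//.
by apply: sumr_ge0 => j _; rewrite mulr_ge0// ltW// normal_pdf_gt0.
Qed.

Let cond_density y : has_density (@lebesgue_measure R) (condP m s n y) (cond_pdf y).
Proof. by apply: has_density_mixture => i; exact: normal_prob_density. Qed.

Let step_density : has_density (@lebesgue_measure R) (stepP m s n p tau) step_pdf.
Proof. by apply: has_density_mixture => i; exact: normal_prob_density. Qed.

Let base_density :
  has_density (@lebesgue_measure R) (normal_prob 0 s) base_pdf.
Proof. exact: normal_prob_density. Qed.

Let cond_pdf_gt0 y x : 0 < cond_pdf y x.
Proof.
by apply: mixture_pdf_gt0 => [i|]; [exact: posterior_ge0|exact: posterior_sum].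
Qed.

Let step_pdf_gt0 x : 0 < step_pdf x.
Proof.
by apply: mixture_pdf_gt0 => [i|]; [exact: weight_ge0|exact: sum_weight].
Qed.

Let base_pdf_gt0 x : 0 < base_pdf x.
Proof. exact: normal_pdf_gt0. Qed.

Hypothesis m0 : forall i k, 0 <= tnth (m i) k.

(** Both pairs have the same second law, so only the masses that [condP] and [stepP] give to an
    upset remain to be compared. *)
Lemma remove_dominates y : above_thresholds y ->
  dominates (procedure_output m s n Remove p tau) (condP m s n y, condQ s y).
Proof.
move=> good g g0 /=.
apply: (hockey_stick_le (mu := @lebesgue_measure R) (ltW g0) (cond_pdf_gt0 y) step_pdf_gt0
  (cond_density y) base_density step_density base_density).
apply: leeD2r; apply: (condP_le_stepP_upset good).
  by apply: measurable_superlevel;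
    [have [] := cond_density y|have [] := base_density].
move=> u v uv /=; apply: mixture_superlevel_upset => // i.
exact: posterior_ge0.
Qed.

(** Here the mixtures come second and enter with the opposite sign: on the downset where the excess
    is positive, [stepP] must have the smaller mass. *)
Lemma add_dominates y : above_thresholds y ->
  dominates (procedure_output m s n Add p tau) (condQ s y, condP m s n y).
Proof.
move=> good g g0 /=.
apply: (hockey_stick_le (mu := @lebesgue_measure R) (ltW g0) base_pdf_gt0 base_pdf_gt0
  base_density (cond_density y) base_density step_density).
apply: leeD2l; apply: lee_wpmul2l; first by rewrite lee_fin ltW.
apply: (stepP_le_condP_downset good).
  by apply: measurable_superlevel;
    [have [] := base_density|have [] := cond_density y].
move=> u v uv /=; apply: mixture_sublevel_downset => // [i|].
  exact: posterior_ge0.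
exact: ltW.
Qed.

Let measurable_cond_pdf : measurable_fun setT
  (fun z : N.-tuple (measurableTypeR R) * measurableTypeR R => cond_pdf z.1 z.2).
Proof.
apply: measurable_sum => i; apply: measurable_funM.
  apply: (measurableT_comp (f := fun y => posterior m s n y i)) => //.
  have mg j : measurable_fun setT (fun y : N.-tuple (measurableTypeR R) =>
      gauss_pdf (Defs.prefix n (m j)) s (Defs.prefix n y)).
    exact: measurableT_comp (measurable_gauss_pdf s0 _) (measurable_prefix (n := n)).
  apply: measurable_funM; first exact: mg.
  apply: (measurable_funV_gt0 (f := fun y : N.-tuple (measurableTypeR R) =>
    \sum_j gauss_pdf (Defs.prefix n (m j)) s (Defs.prefix n y))).
    move=> y; rewrite (bigD1 (Ordinal b0))//= ltr_wpDr ?gauss_pdf_gt0//.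
    by apply: sumr_ge0 => j _; exact: gauss_pdf_ge0.
  by apply: measurable_sum => j.
exact: measurableT_comp (measurable_normal_pdf _ _) measurable_snd.
Qed.

Let measurable_base_pdf : measurable_fun setT
  (fun z : N.-tuple (measurableTypeR R) * measurableTypeR R => base_pdf z.2).
Proof. exact: measurableT_comp (measurable_normal_pdf _ _) measurable_snd. Qed.

Lemma measurable_remove_dominates :
  measurable [set y : N.-tuple (measurableTypeR R) |
    dominates (procedure_output m s n Remove p tau) (condP m s n y, condQ s y)].
Proof.
exact: (measurable_dominates (mu := @lebesgue_measure R) (p := cond_pdf) (q := fun=> base_pdf)
  step_pdf_gt0 cond_pdf_gt0 step_density base_density cond_density
  (fun=> base_density)).
Qed.

Lemma measurable_add_dominates :
  measurable [set y : N.-tuple (measurableTypeR R) |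
    dominates (procedure_output m s n Add p tau) (condQ s y, condP m s n y)].
Proof.
exact: (measurable_dominates (mu := @lebesgue_measure R) (p := fun=> base_pdf) (q := cond_pdf)
  base_pdf_gt0 (fun=> base_pdf_gt0) base_density step_density
  (fun=> base_density) cond_density).
Qed.

Lemma tildeR_dominates rel i : tildeR m s n rel p `<< tildeQ m s n p i.
Proof.
case: rel; last exact: has_density_dominates (gauss_density s0 _ _).
apply: has_density_dominates; apply: has_density_mixture => k.
exact: gauss_density.
Qed.

Lemma measurable_below_threshold i : measurable
  [set x : n.-tuple (measurableTypeR R) | likelihood_ratio i x < expR (tau i)].
Proof.
have [mr _ _] := likelihood_ratio_density i.
rewrite -[X in measurable X]setTI.
exact: (measurable_fun_ltr mr (@measurable_cst _ _ _ _ setT (expR (tau i)))).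
Qed.

(** Treats both relations at once: [mu] is the law of [y], and its prefix has law [tildeR]. *)
Lemma procedure_probability rel beta
    (mu : {finite_measure set (N.-tuple (measurableTypeR R)) -> \bar R})
    (D : set (N.-tuple (measurableTypeR R))) :
    mu setT = 1%E ->
    (forall B, measurable B ->
      mu (Defs.prefix n @^-1` B) = tildeR m s n rel p B) ->
    0 <= beta -> valid_thresholds m s n beta rel p tau -> measurable D ->
    (forall y, above_thresholds y -> D y) ->
  ((1 - beta)%:E <= mu D)%E.
Proof.
move=> mu1 muE beta0 valid mD goodD.
have le := @union_bound _ _ _ mu b (fun i : 'I_b => 0 < i)%N
  (fun i => Defs.prefix n @^-1` [set x | likelihood_ratio i x < expR (tau i)]) D
  (beta / (b%:R - 1)) mu1.
apply: le_trans (le _ mD _ goodD).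
- rewrite -EFinB lee_fin lerD2l lerN2.
  have -> : #|(fun i : 'I_b => 0 < i)%N| = b.-1.
    case: b b0 => // k _; rewrite -[RHS](card_ord k) -sum1_card.
    rewrite big_mkcond big_ord_recl/= add0n sum1_card.
    by [].
  have -> : b%:R - 1 = b.-1%:R :> R by case: b b0 => // k _; rewrite -natr1 addrK.
  (* With a single component there is no exceptional event and the bound reads [0 <= beta];
     otherwise the factor [b - 1] cancels. *)
  have [->|b1] := eqVneq b.-1 0%N; first by rewrite mul0r.
  by rewrite mulrCA divff ?mulr1// pnatr_eq0.
- move=> i; rewrite -[X in measurable X]setTI.
  exact: measurable_prefix (measurable_below_threshold i).
- move=> i i0; rewrite muE; last exact: measurable_below_threshold.
  apply: le_trans (valid i i0).
  apply: measure_lne_Radon_Nikodym; last exact: tildeR_dominates.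
  exact: likelihood_ratio_density.
Qed.

Lemma uniform_mixture_setT d (T : measurableType d)
    (P : 'I_b -> probability T R) : uniform_mixture P setT = 1%E.
Proof.
transitivity (\sum_(i < b) (b%:R^-1)%:E * P i setT)%E => //.
under eq_bigr do rewrite probability_setT mule1.
by rewrite sumEFin sumr_const card_ord -(mulr_natl b%:R^-1) divff// pnatr_eq0 -lt0n.
Qed.

(** [tildeR] lists the components in sorted order, hence the reindexing by [p]. *)
Lemma uniform_gauss_prefix B : measurable B ->
  uniform_mixture (fun i : 'I_b => gauss (m i) s) (Defs.prefix n @^-1` B) =
  tildeR m s n Remove p B.
Proof.
move=> mB; transitivity (\sum_(i < b) (b%:R^-1)%:E *
  gauss (m i) s (Defs.prefix n @^-1` B))%E => //.
rewrite (reindex_inj (@perm_inj _ p)).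
by under eq_bigr do rewrite gauss_prefix//.
Qed.

Lemma zero_gauss_prefix B : measurable B ->
  gauss (zero_vec R N) s (Defs.prefix n @^-1` B) = tildeR m s n Add p B.
Proof.
move=> mB; rewrite (gauss_prefix _ _ mB).
have -> : Defs.prefix n (zero_vec R N) = zero_vec R n; last reflexivity.
by apply: eq_from_tnth => i; rewrite !tnth_mktuple.
Qed.

End procedure_correctness.

Theorem theorem4p6 (R : realType) (b N : nat) (hb : (1 <= b)%N) (hN : (1 <= N)%N)
    (s : R) (hs : 0 < s)
    (m : 'I_b -> N.-tuple R) (hm : forall i k, 0 <= tnth (m i) k)
    (n : 'I_N) (beta : R) (hbeta : 0 < beta < 1) :
  (forall (p : {perm 'I_b}) (tau : 'I_b -> R),
     sorts m n p -> valid_thresholds m s n beta Remove p tau ->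
     ((1 - beta)%R%:E <=
        uniform_mixture (fun i : 'I_b => gauss (m i) s)
          [set y | dominates (procedure_output m s n Remove p tau)
                             (condP m s n y, condQ s y)])%E)
  /\
  (forall (p : {perm 'I_b}) (tau : 'I_b -> R),
     sorts m n p -> valid_thresholds m s n beta Add p tau ->
     ((1 - beta)%R%:E <=
        gauss (zero_vec R N) s
          [set y | dominates (procedure_output m s n Add p tau)
                             (condQ s y, condP m s n y)])%E).
Proof.
have /andP[/ltW beta0 _] := hbeta.
split=> p tau sorted_p valid.
- apply: (procedure_probability hb hs _ _ beta0 valid).
  + exact: uniform_mixture_setT.
  + exact: uniform_gauss_prefix.
  + exact: measurable_remove_dominates.
  + by move=> y good; exact: remove_dominates.
- apply: (procedure_probability hb hs _ _ beta0 valid).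
  + exact: probability_setT.
  + exact: zero_gauss_prefix.
  + exact: measurable_add_dominates.
  + by move=> y good; exact: add_dominates.
Qed.
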